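(* Let $R=(r,s,t,R_1,\dots,R_r,C_1,\dots,C_s)$ be a balanced framework. Then for every integer $n\ge\max\{t,r+s\}$ there is an L-shaped partial latin square $P$ of order $n$, whose upper left $r\times s$ rectangle is empty and all of whose other cells are filled, such that for each $1\le i\le r$ the set of symbols missing from row $i$ of $P$ is $R_i$, and for each $1\le j\le s$ the set of symbols missing from column $j$ of $P$ is $C_j$. Moreover, such a $P$ can be found in time polynomial in the size of $R$ and $n$.
   Context: A framework is a tuple $R=(r,s,t,R_1,\dots,R_r,C_1,\dots,C_s)$ with $r,s,t$ positive integers and $R_1,\dots,R_r,C_1,\dots,C_s\subseteq\{1,\dots,t\}$. It is balanced if $|R_i|=s$ for all $i$, $|C_j|=r$ for all $j$, and each symbol appears in the same number of the sets $R_1,\dots,R_r$ as of the sets $C_1,\dots,C_s$. A partial latin square of order $n$ is an $n\times n$ array in which some cells are filled with symbols from $\{1,\dots,n\}$, no symbol appearing twice in any row or column. A symbol is missing from a row (column) if it does not appear in a filled cell of that row (column). *)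

(* Defs.v *)
From mathcomp Require Import all_boot matrix.

Set Implicit Arguments.
Unset Strict Implicit.
Unset Printing Implicit Defensive.

(* Rows, columns and symbols are numbered from 0: the symbol set {1, ..., t}  *)
(* is 'I_t, and the symbol x : 'I_t stands for x + 1.                         *)

Record framework := Framework {
  nrow : nat;
  ncol : nat;
  nsym : nat;
  nrow_gt0 : 0 < nrow;
  ncol_gt0 : 0 < ncol;
  nsym_gt0 : 0 < nsym;
  rowset : 'I_nrow -> {set 'I_nsym};
  colset : 'I_ncol -> {set 'I_nsym} }.

Definition balanced (R : framework) : Prop :=
  [/\ forall i : 'I_(nrow R), #|rowset i| = ncol R,
      forall j : 'I_(ncol R), #|colset j| = nrow R &
      forall x : 'I_(nsym R),
        #|[set i : 'I_(nrow R) | x \in rowset i]|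
        = #|[set j : 'I_(ncol R) | x \in colset j]| ].

(* [None] is an empty cell. *)
Definition partial_latin n (P : 'M[option 'I_n]_n) : Prop :=
  (forall (i j j' : 'I_n) (x : 'I_n),
     P i j = Some x -> P i j' = Some x -> j = j') /\
  (forall (i i' j : 'I_n) (x : 'I_n),
     P i j = Some x -> P i' j = Some x -> i = i').

Definition row_missing n (P : 'M[option 'I_n]_n) (i : 'I_n) : {set 'I_n} :=
  [set x : 'I_n | [forall j : 'I_n, P i j != Some x]].

Definition col_missing n (P : 'M[option 'I_n]_n) (j : 'I_n) : {set 'I_n} :=
  [set x : 'I_n | [forall i : 'I_n, P i j != Some x]].

(* A set of symbols from {1, ..., t}, seen as a subset of {1, ..., n}; this   *)
(* loses no element when t <= n.                                              *)
Definition symbols n t (A : {set 'I_t}) : {set 'I_n} :=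
  [set x : 'I_n | [exists y in A, val y == val x]].

Definition realizes (R : framework) n (P : 'M[option 'I_n]_n) : Prop :=
  [/\ partial_latin P,
      forall i j : 'I_n, (P i j == None) = (i < nrow R) && (j < ncol R),
      forall (i : 'I_n) (hi : i < nrow R),
        row_missing P i = symbols n (rowset (Ordinal hi)) &
      forall (j : 'I_n) (hj : j < ncol R),
        col_missing P j = symbols n (colset (Ordinal hj)) ].

(* Running time is measured on a unit-cost random access machine, programmed  *)
(* by while programs over registers and two-dimensional arrays of natural     *)
(* numbers.  The only arithmetic is addition and truncated subtraction (with  *)
(* unit-cost multiplication, repeated squaring would build numbers of         *)
(* exponential length), so polynomial time here is polynomial time on a       *)
(* Turing machine.                                                            *)

Inductive expr : Type :=
| Const of nat
| Reg of nat
| Cell of nat & expr & expr            (* Cell a i j is a[i, j] *)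
| Plus of expr & expr
| Minus of expr & expr.

Inductive cmd : Type :=
| Skip
| Assign of nat & expr
| Store of nat & expr & expr & expr    (* Store a i j e is a[i, j] := e *)
| Seq of cmd & cmd
| If of expr & cmd & cmd
| While of expr & cmd.

Record state := State {
  reg : nat -> nat;
  mem : nat -> nat -> nat -> nat }.

Fixpoint eval (st : state) (e : expr) : nat :=
  match e with
  | Const m => m
  | Reg x => reg st x
  | Cell a i j => mem st a (eval st i) (eval st j)
  | Plus e1 e2 => eval st e1 + eval st e2
  | Minus e1 e2 => eval st e1 - eval st e2
  end.

Definition set_reg (st : state) (x v : nat) : state :=
  State (fun y => if y == x then v else reg st y) (mem st).

Definition set_mem (st : state) (a i j v : nat) : state :=
  State (reg st)
    (fun b k l => if [&& b == a, k == i & l == j] then v else mem st b k l).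

(* [exec c st st' T]: started in [st], the program [c] halts in [st'] after   *)
(* [T] steps.  A condition holds when its value is nonzero.  An elementary    *)
(* command or a test is one step, whatever its expressions: they occur in the *)
(* program, so their size is a constant.                                      *)
Inductive exec : cmd -> state -> state -> nat -> Prop :=
| exec_skip st : exec Skip st st 1
| exec_assign st x e : exec (Assign x e) st (set_reg st x (eval st e)) 1
| exec_store st a i j e :
    exec (Store a i j e) st
      (set_mem st a (eval st i) (eval st j) (eval st e)) 1
| exec_seq c1 c2 st1 st2 st3 T1 T2 :
    exec c1 st1 st2 T1 -> exec c2 st2 st3 T2 ->
    exec (Seq c1 c2) st1 st3 (T1 + T2)
| exec_if_true e c1 c2 st st' T :
    eval st e != 0 -> exec c1 st st' T -> exec (If e c1 c2) st st' T.+1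
| exec_if_false e c1 c2 st st' T :
    eval st e = 0 -> exec c2 st st' T -> exec (If e c1 c2) st st' T.+1
| exec_while_true e c st1 st2 st3 T1 T2 :
    eval st1 e != 0 -> exec c st1 st2 T1 -> exec (While e c) st2 st3 T2 ->
    exec (While e c) st1 st3 (T1 + T2).+1
| exec_while_false e c st :
    eval st e = 0 -> exec (While e c) st st 1.

Lemma exec_det c st st1 st2 T1 T2 :
  exec c st st1 T1 -> exec c st st2 T2 -> st1 = st2 /\ T1 = T2.
Proof.
move=> H; elim: H st2 T2 => {c st st1 T1}; intros.
all: match goal with H : exec ?c _ ?s ?T |- _ = ?s /\ _ = ?T =>
    inversion H; subst; clear H end => //.
all: repeat match goal with
  | H : is_true (?x != 0), E : ?x = 0 |- _ => by rewrite E in H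
  | IH : forall s T, exec ?c ?s0 s T -> _, H : exec ?c ?s0 _ _ |- _ =>
      case: (IH _ _ H) => ? ?; subst; clear H
  end => //.
Qed.

(* Registers 0, 1, 2, 3 hold r, s, t, n; array 0 is the incidence table of    *)
(* R_1, ..., R_r and array 1 that of C_1, ..., C_s; all else is 0.            *)
Definition incidence m t (A : 'I_m -> {set 'I_t}) (i x : nat) : bool :=
  [exists i' : 'I_m, exists x' : 'I_t,
     [&& val i' == i, val x' == x & x' \in A i']].

Definition input (R : framework) (n : nat) : state :=
  State
    (fun x => nth 0 [:: nrow R; ncol R; nsym R; n] x)
    (fun a i x =>
       match a with
       | 0 => nat_of_bool (incidence (@rowset R) i x)
       | 1 => nat_of_bool (incidence (@colset R) i x)
       | _ => 0
       end).

(* The result is read from array 2, where 0 marks an empty cell. *)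
Definition outputs (st : state) n (P : 'M[option 'I_n]_n) : Prop :=
  forall i j : 'I_n, mem st 2 i j = if P i j is Some x then x.+1 else 0.

(* The number of bits of the incidence tables, which is at least r, s and t.  *)
Definition framework_size (R : framework) : nat :=
  (nrow R + ncol R) * nsym R.

(* Main.v *)
(* The array is filled by two proper edge colourings of bipartite graphs.     *)
(* First, columns 1, ..., s are joined to the symbols they must contain (x    *)
(* with x not in C_j) and the edges are coloured by the rows r+1, ..., n:     *)
(* every column has degree n - r, and every symbol has degree at most s <= n  *)
(* - r. Then each row is joined to the symbols that it must contain to the    *)
(* right of column s. By balance this graph is (n - s)-regular: x occurs s -  *)
(* f x times in the lower left part and is forbidden in f x of the first r    *)
(* rows, where f x counts the sets R_i (or C_j) that contain x. Its colour    *)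
(* classes are the columns s+1, ..., n. Edges are inserted one at a time; a   *)
(* conflict is resolved by following a Kempe chain, whose length is at most n *)
(* because it meets no symbol twice.                                          *)

Require Import Defs.
From mathcomp Require Import all_boot matrix.
From mathcomp Require Import zify.

Set Implicit Arguments.
Unset Strict Implicit.
Unset Printing Implicit Defensive.

(** Both parts of the array are proper edge colourings of bipartite graphs, and these exist by
    König's theorem as soon as no degree exceeds the number of colours. A new edge has a colour [a]
    free at one end and a colour [b] free at the other, because it is itself still uncoloured
    ([free_colour]). [pending_step] pushes the conflict along the path coloured alternately [a] and
    [b]; this path never comes back to a symbol, so the insertion succeeds. At a vertex whose degree
    equals the number of colours every colour occurs ([saturated]), hence no cell outside the corner
    stays empty.

    The crux is that, once the lower left part is filled, every row and every symbol has exactly [s]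
    forbidden partners ([barred_row], [barred_col]), so the second graph is regular of degree
    [n - s]. For a symbol this is where the two counts in the balance condition meet: the columns
    whose set keeps it out of the lower left part are as many as the top rows that must miss it.

    Both colourings are computed by [program] in a cubic number of steps, and the existence
    statement is read off from its output. *)

Local Notation mem := Defs.mem.

(** * Total correctness of programs with step bounds *)

Definition hoare (B : nat) (P : state -> Prop) c (Q : state -> Prop) :=
  forall st, P st -> exists st' T, [/\ exec c st st' T, T <= B & Q st'].

Fixpoint loop_free c :=
  match c with
  | Seq c1 c2 | If _ c1 c2 => loop_free c1 && loop_free c2
  | While _ _ => false
  | _ => true
  end.

Fixpoint cmd_size c :=
  match c with
  | Seq c1 c2 => cmd_size c1 + cmd_size c2
  | If _ c1 c2 => (cmd_size c1 + cmd_size c2).+1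
  | _ => 1
  end.

(* Meaningful on loop-free commands only. *)
Fixpoint run c st :=
  match c with
  | Skip => st
  | Assign x e => set_reg st x (eval st e)
  | Store a i j e => set_mem st a (eval st i) (eval st j) (eval st e)
  | Seq c1 c2 => run c2 (run c1 st)
  | If e c1 c2 => if eval st e == 0 then run c2 st else run c1 st
  | While _ _ => st
  end.

Lemma run_exec c st :
  loop_free c -> exists2 T, exec c st (run c st) T & T <= cmd_size c.
Proof.
elim: c st => //= [|x e|a i j e|c1 IH1 c2 IH2|e c1 IH1 c2 IH2] st.
- by exists 1; [constructor|].
- by exists 1; [constructor|].
- by exists 1; [constructor|].
- case/andP=> /(IH1 st)[T1 H1 L1] /(IH2 (run c1 st))[T2 H2 L2].
  by exists (T1 + T2); [apply: exec_seq H1 H2|lia].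
- case/andP=> /(IH1 st)[T1 H1 L1] /(IH2 st)[T2 H2 L2].
  have [E|E] := eqVneq (eval st e) 0.
    by exists T2.+1; [apply: exec_if_false|lia].
  by exists T1.+1; [apply: exec_if_true|lia].
Qed.

Lemma hoare_run (P Q : state -> Prop) c :
  loop_free c -> (forall st, P st -> Q (run c st)) -> hoare (cmd_size c) P c Q.
Proof.
move=> lf PQ st /PQ Qst; have [T H L] := run_exec st lf.
by exists (run c st), T.
Qed.

Lemma hoare_weaken B B' (P P' Q Q' : state -> Prop) c :
  B <= B' -> (forall st, P' st -> P st) -> (forall st, Q st -> Q' st) ->
  hoare B P c Q -> hoare B' P' c Q'.
Proof.
move=> leB P'P QQ' H st /P'P /H [st' [T [Hx L /QQ' HQ]]].
by exists st', T; split=> //; apply: leq_trans leB.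
Qed.

Lemma hoare_seq B1 B2 (P Q S : state -> Prop) c1 c2 :
  hoare B1 P c1 Q -> hoare B2 Q c2 S -> hoare (B1 + B2) P (Seq c1 c2) S.
Proof.
move=> H1 H2 st /H1 [st1 [T1 [X1 L1 /H2 [st2 [T2 [X2 L2 HS]]]]]].
by exists st2, (T1 + T2); split=> //; [apply: exec_seq X1 X2|lia].
Qed.

Lemma hoare_if B (P Q : state -> Prop) e c1 c2 :
  hoare B (fun st => P st /\ eval st e != 0) c1 Q ->
  hoare B (fun st => P st /\ eval st e = 0) c2 Q ->
  hoare B.+1 P (If e c1 c2) Q.
Proof.
move=> H1 H2 st Pst; have [E|E] := eqVneq (eval st e) 0.
  have [st' [T [X L HQ]]] := H2 st (conj Pst E).
  by exists st', T.+1; split=> //; apply: exec_if_false.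
have [st' [T [X L HQ]]] := H1 st (conj Pst E).
by exists st', T.+1; split=> //; apply: exec_if_true.
Qed.

(** The index of [I] is fuel: a round consumes one unit, and without fuel the test must fail. A
    round costs [B.+1] with its test, and the failing test costs one more step. *)
Lemma hoare_while B (I : nat -> state -> Prop) e c m :
  (forall k st, I k st -> eval st e != 0 -> 0 < k) ->
  (forall k, hoare B (fun st => I k.+1 st /\ eval st e != 0) c (I k)) ->
  hoare (m * B.+1).+1 (I m) (While e c)
    (fun st => (exists k, I k st) /\ eval st e = 0).
Proof.
move=> I_gt0 Hc; elim: m => [|m IHm] st Ist.
all: have [E|E] := eqVneq (eval st e) 0;
  first by exists st, 1; split=> //;
    [apply: exec_while_false|split=> //; eexists; exact: Ist].
  by have := I_gt0 _ _ Ist E.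
have [st1 [T1 [X1 L1 /IHm [st2 [T2 [X2 L2 HQ]]]]]] := Hc m st (conj Ist E).
exists st2, (T1 + T2).+1; split=> //; first exact: exec_while_true X1 X2.
lia.
Qed.

Definition For x lo hi c :=
  Seq (Assign x lo)
    (While (Minus hi (Reg x)) (Seq c (Assign x (Plus (Reg x) (Const 1))))).

Lemma hoare_for B (I : nat -> state -> Prop) (P : state -> Prop) x lo hi m n c :
  m <= n ->
  (forall st, P st -> eval st lo = m /\ I m (set_reg st x m)) ->
  (forall k st, I k st -> reg st x = k /\ eval st hi = n) ->
  (forall k, m <= k < n ->
     hoare B (I k) c (fun st => I k.+1 (set_reg st x (reg st x).+1))) ->
  hoare (n * (B + 2) + 2) P (For x lo hi c) (I n).
Proof.
move=> le_mn HP HI Hc.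
(* The fuel [d] is the number of rounds left; its bound keeps the index [n - d] at or above [m]. *)
pose J d st := d <= n - m /\ I (n - d) st.
apply: (@hoare_weaken (1 + ((n - m) * (B + 1).+1).+1) _ P _ (I n)) => //.
  have : (n - m) * (B + 1).+1 <= n * (B + 1).+1 by rewrite leq_mul2r leq_subr orbT.
  lia.
apply: (@hoare_seq _ _ _ (J (n - m))).
  apply: (@hoare_run _ _ (Assign x lo)) => // st /HP[E Im] /=; split=> //.
  by rewrite E subKn.
apply: hoare_weaken (@hoare_while (B + 1) J _ _ _ _ _) => //.
- move=> st [[d [led Id]] /= E]; have [E1 E2] := HI _ _ Id.
  by move: Id; have -> : n - d = n by lia.
- move=> d st [led Id] /= E; have [E1 E2] := HI _ _ Id; lia.
move=> d; case: (ltnP d (n - m)) => ltd; last first.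
  by move=> st [[]]; lia.
have En : (n - d.+1).+1 = n - d by lia.
apply: (@hoare_seq _ _ _ (fun st => I (n - d) (set_reg st x (reg st x).+1))).
  apply: hoare_weaken (Hc (n - d.+1) _) => //; last lia.
    by move=> st [[]].
  by rewrite En.
apply: (@hoare_run _ _ (Assign x (Plus (Reg x) (Const 1)))) => // st.
by rewrite /J /= addn1; split=> //; exact: ltnW.
Qed.

Definition For2 lo1 hi1 hi2 c :=
  For 4 lo1 hi1 (For 5 (Const 0) hi2 c).

(** [I i j] describes the progress when the pairs before [(i, j)] in row-major order have been
    treated. It must ignore the registers from 4 on, so that counters and scratch registers may
    change under it. *)
Lemma hoare_for2 B (I : nat -> nat -> state -> Prop) (P : state -> Prop)
    lo1 h1 h2 m N M n c :
  m <= N -> N <= n -> M <= n -> h1 < 4 -> h2 < 4 ->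
  (forall st, P st -> eval st lo1 = m /\ I m 0 st) ->
  (forall i j st, I i j st -> reg st h1 = N /\ reg st h2 = M) ->
  (forall i j st x v, 3 < x -> I i j st -> I i j (set_reg st x v)) ->
  (forall i st, I i M st -> I i.+1 0 st) ->
  (forall i j, m <= i < N -> j < M ->
     hoare B (fun st => [/\ I i j st, reg st 4 = i & reg st 5 = j]) c
       (fun st => [/\ I i j.+1 st, reg st 4 = i & reg st 5 = j])) ->
  hoare (n * (n * (B + 2) + 4) + 2) P
    (For2 lo1 (Reg h1) (Reg h2) c) (I N 0).
Proof.
move=> le_mN leN leM lt1 lt2 HP HI Hreg Hnext Hc.
have ne x y : x < 4 -> 3 < y -> (x == y) = false by lia.
apply: (@hoare_weaken (N * ((M * (B + 2) + 2) + 2) + 2) _ P _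
          (fun st => I N 0 st /\ reg st 4 = N)) => // [|st []//|].
  rewrite leq_add2r; apply: leq_mul => //.
  rewrite -addnA leq_add2r; exact: leq_mul.
apply: (@hoare_for _ (fun i st => I i 0 st /\ reg st 4 = i) _ _ _ _ m) => //.
- by move=> st /HP[E Im]; split=> //; split=> //; apply: Hreg.
- by move=> k st [/HI[E _] E4].
move=> i Hi.
apply: (@hoare_weaken (M * (B + 2) + 2) _ (fun st => I i 0 st /\ reg st 4 = i) _
         (fun st => [/\ I i M st, reg st 4 = i & reg st 5 = M])) => //.
  move=> st [IM E4 _]; split; first by apply: Hreg => //; apply: Hnext.
  by rewrite /= E4.
apply: (@hoare_for _ (fun j st => [/\ I i j st, reg st 4 = i & reg st 5 = j])
          _ _ _ _ 0) => //.
- by move=> st [I0 E4]; split=> //; split=> //; apply: Hreg.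
- by move=> k st [/HI[_ E] _ E5].
move=> j /andP[_ ltj]; apply: hoare_weaken (Hc _ _ Hi ltj) => // st [IJ E4 E5].
by split=> //=; [apply: Hreg|rewrite E5].
Qed.

(** * Bipartite edge colourings and Kempe chains *)

Section Colouring.

Variables lo n : nat.

Definition upd (f : nat -> nat -> nat) i j v :=
  fun k l => if (k == i) && (l == j) then v else f k l.

(* [A u c] is [x.+1] when the edge between [u] and [x] has colour [c], and    *)
(* [B x c] is then [u.+1]; the value 0 means that [c] is free.                *)
Definition colouring (F : rel nat) (A B : nat -> nat -> nat) :=
  [/\ forall u c x, A u c = x.+1 <-> B x c = u.+1,
      forall u c x, A u c = x.+1 -> lo <= c < n,
      forall u c c' x, A u c = x.+1 -> A u c' = x.+1 -> c = c' &
      forall u x, F u x <-> exists c, A u c = x.+1].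

Definition minus (E : rel nat) v y : rel nat :=
  fun u x => E u x && ((u, x) != (v, y)).

Lemma colouring_ext F F' A A' B B' :
  F =2 F' -> A =2 A' -> B =2 B' -> colouring F A B -> colouring F' A' B'.
Proof.
move=> eF eA eB [D L J C]; split=> [u c x|u c x|u c c' x|u x].
- by rewrite -eA -eB.
- by rewrite -eA; exact: L.
- by rewrite -!eA; exact: J.
rewrite -eF C; split=> -[c]; exists c; first by rewrite -eA.
by rewrite eA.
Qed.

Lemma colouring_sym F A B :
  colouring F A B -> colouring (fun x u => F u x) B A.
Proof.
move=> [D L J C]; split=> [u c x|u c x|u c c' x|u x].
- by split=> /D.
- by move=> /D /L.
- by move=> /D H /D; exact: J H.
by rewrite C; split=> -[c] /D; exists c.
Qed.

Lemma minus_sym E v y A B :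
  colouring (minus E v y) A B -> colouring (minus (fun x u => E u x) y v) B A.
Proof.
move/colouring_sym; apply: colouring_ext => // x u.
by rewrite /minus !xpair_eqE [in RHS]andbC; case: (x == y); case: (u == v);
  rewrite ?andbT ?andbF.
Qed.

Lemma colouring_link F v y a A B :
  colouring F A B -> A v a = 0 -> B y a = 0 -> ~~ F v y -> lo <= a < n ->
  colouring (fun u x => F u x || ((u, x) == (v, y)))
    (upd A v a y.+1) (upd B y a v.+1).
Proof.
move=> [D L J C] Av By nF La; rewrite /upd; split=> [u c x|u c x|u c c' x|u x].
- rewrite andbC [in X in _ <-> X]andbC.
  case: (eqVneq c a) => [->|_] /=; last exact: D.
  case: (eqVneq u v) => [->|uv]; case: (eqVneq x y) => [->|xy] //.
  + split=> [[/esym E]|/D]; first by rewrite E eqxx in xy.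
    by rewrite Av.
  + split=> [/D|[/esym E]]; first by rewrite By.
    by rewrite E eqxx in uv.
- by case: ifP => [/andP[_ /eqP->]|_ /L].
- case: ifP => [/andP[/eqP-> /eqP->] [<-]|_].
    by case: ifP => [/andP[_ /eqP->]//|_ E]; case/negP: nF; apply/C; exists c'.
  move=> E; case: ifP => [/andP[/eqP Eu _] [Ex]|_]; last exact: J E.
  by case/negP: nF; apply/C; exists c; rewrite -Eu Ex.
- split=> [/orP[/C[c Ac]|/eqP[-> ->]]|[c]].
  + exists c; case: ifP => // /andP[/eqP Eu /eqP Ec].
    by rewrite Eu Ec Av in Ac.
  + by exists a; rewrite !eqxx.
  case: ifP => [/andP[/eqP-> _] [->]|_ E]; first by rewrite eqxx orbT.
  by apply/orP; left; apply/C; exists c.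
Qed.

Lemma colouring_unlink F v y a A B :
  colouring F A B -> A v a = y.+1 ->
  colouring (minus F v y) (upd A v a 0) (upd B y a 0).
Proof.
move=> [D L J C] Av; have By := (D _ _ _).1 Av.
rewrite /upd; split=> [u c x|u c x|u c c' x|u x].
- rewrite andbC [in X in _ <-> X]andbC.
  case: (eqVneq c a) => [->|_] /=; last exact: D.
  case: (eqVneq u v) => [->|uv]; case: (eqVneq x y) => [->|xy] //.
  + split=> // /D; rewrite Av => -[E]; by rewrite E eqxx in xy.
  + split=> // /D; rewrite By => -[E]; by rewrite E eqxx in uv.
- by case: ifP => // _ /L.
- by case: ifP => // _ E; case: ifP => // _; exact: J E.
- rewrite /minus; split=> [/andP[/C[c Ac] ne]|[c]].
  + exists c; case: ifP => // /andP[/eqP Eu /eqP Ec].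
    by move: Ac ne; rewrite Eu Ec Av => -[->]; rewrite eqxx.
  case: ifP => // ne E; apply/andP; split; first by apply/C; exists c.
  apply/eqP=> -[Eu Ex]; rewrite Eu Ex in E; move: ne.
  by rewrite Eu (J _ _ _ _ E Av) !eqxx.
Qed.

(** Edge [v y] takes colour [a] by force, and the edge that held [a] at [y], if any, loses it. In
    the opposite table a plain [upd] suffices, since the new entry overwrites the old one. *)
Definition evictA (A B : nat -> nat -> nat) v y a :=
  upd (if B y a is w.+1 then upd A w a 0 else A) v a y.+1.

Lemma evictA_ext A A' B B' v y a :
  A =2 A' -> B =2 B' -> evictA A B v y a =2 evictA A' B' v y a.
Proof.
move=> eA eB k l; rewrite /evictA eB.
by case: (B' y a) => [|w]; rewrite /upd eA.
Qed.

(** At most one edge is uncoloured at any time: forcing a colour on it either completes the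
    colouring or moves the defect to the evicted edge. *)
Lemma colouring_evict E v y a A B :
  colouring (minus E v y) A B -> E v y -> A v a = 0 -> lo <= a < n ->
  if B y a is w.+1 then
    E w y /\ colouring (minus E w y) (evictA A B v y a) (upd B y a v.+1)
  else colouring E (evictA A B v y a) (upd B y a v.+1).
Proof.
move=> col Evy Av La; rewrite /evictA; have [D L J C] := col.
case By: (B y a) => [|w].
  have := colouring_link col Av By; rewrite /minus eqxx andbF.
  move/(_ isT La); apply: colouring_ext => // u x.
  by case: eqVneq => [[-> ->]|_]; rewrite ?andbT ?orbF ?orbT ?Evy.
have Aw := (D _ _ _).2 By.
have wv : w != v by apply/eqP=> E1; rewrite E1 Av in Aw.
have /andP[Ewy _] : minus E v y w y by apply/C; exists a.
split=> //.
have col1 := colouring_unlink col Aw.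
have := colouring_link col1 (v := v) (y := y) (a := a).
rewrite /upd !eqxx Av /minus eqxx !andbF /= if_same => /(_ erefl erefl isT La).
apply: colouring_ext => // u x; last by case: andP.
case: (eqVneq (u, x) (v, y)) => [[-> ->]|_]; last by rewrite andbT orbF.
by rewrite Evy orbT; apply/esym/eqP=> -[/esym/eqP]; rewrite (negPf wv).
Qed.

(* The symbols already traversed by a chain of evictions alternating between  *)
(* colours [a] and [b], whose pending edge is at [v]: the chain leads from    *)
(* each of them to another one or to [v], so it cannot come back to them.     *)
Definition visited (A B : nat -> nat -> nat) a b v (V : seq nat) :=
  forall x, x \in V -> exists2 w, B x b = w.+1 &
    w = v \/ exists2 x', x' \in V & A w a = x'.+1.

Definition pending E A B a b v y V :=
  [/\ colouring (minus E v y) A B, E v y, A v a = 0, B y b = 0 &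
      visited A B a b v V /\ uniq (y :: V)].

(** One round of the chain: [v y] takes [a] from [w y], which takes [b], free at [y], and may
    thereby evict some [w z]. Now [a] is free at [w] and [b] is free at [z], so the situation recurs
    with [w z] in place of [v y]. *)
Lemma pending_step E A B a b v y V w :
  pending E A B a b v y V -> lo <= a < n -> lo <= b < n ->
  B y a = w.+1 ->
  let A1 := evictA A B v y a in
  let B1 := upd B y a v.+1 in
  let A2 := upd A1 w b y.+1 in
  let B2 := evictA B1 A1 y w b in
  if A1 w b is z.+1 then pending E A2 B2 a b w z (y :: V)
  else colouring E A2 B2.
Proof.
case=> col Evy Av By [vis uV] La Lb Bya A1 B1 A2 B2.
(* The colours are searched independently and may coincide, but then [a] is free at [y] and nothing
   is evicted. *)
have ab : (b == a) = false.
  by apply/eqP=> E1; rewrite E1 Bya in By.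
have [D L J C] := col.
have Aw := (D _ _ _).2 Bya.
have wv : (w == v) = false by apply/eqP=> E1; rewrite E1 Av in Aw.
have yV : y \notin V by case/andP: uV.
have := colouring_evict col Evy Av La; rewrite Bya -/A1 -/B1 => -[Ewy col1].
have B1y : B1 y b = 0 by rewrite /B1 /upd ab andbF.
have := colouring_evict (minus_sym col1) Ewy B1y Lb; rewrite -/A2 -/B2.
case A1w : (A1 w b) => [|z]; first exact: colouring_sym.
move=> [Ewz col2].
have Awb : A w b = z.+1.
  move: A1w; rewrite /A1 /evictA /upd Bya.
  by rewrite ab !andbF.
have Bzb := (D _ _ _).1 Awb.
have zy : (z == y) = false by apply/eqP=> E1; rewrite E1 By in Bzb.
(* If [z] were visited, its [b]-neighbour [w] would be [v], where [a] was free, or would have a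
   visited [a]-neighbour; but the [a]-neighbour of [w] is [y], which is new. *)
have zV : z \notin V.
  apply/negP=> /vis [w']; rewrite Bzb => -[<-] [Ew|[x' x'V]].
    by rewrite Ew eqxx in wv.
  by rewrite Aw => -[Ex]; rewrite Ex x'V in yV.
have A2a u : A2 u a = if u == v then y.+1 else if u == w then 0 else A u a.
  by rewrite /A2 /A1 /evictA /upd Bya (eq_sym a) ab !eqxx !andbT andbF.
have B2b x : B2 x b = if x == y then w.+1 else if x == z then 0 else B x b.
  by rewrite /B2 /evictA A1w /B1 /upd ab !eqxx !andbT !andbF.
split=> //.
- exact: minus_sym col2.
- by rewrite A2a wv eqxx.
- by rewrite B2b zy eqxx.
split; last by rewrite /= inE zy zV.
move=> x; rewrite inE => /orP[/eqP->|xV].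
  by exists w; [rewrite B2b eqxx|left].
have xy : (x == y) = false by apply/eqP=> E1; rewrite -E1 xV in yV.
have xz : (x == z) = false by apply/eqP=> E1; rewrite -E1 xV in zV.
have [w' Bx w'V] := vis _ xV; exists w'; first by rewrite B2b xy xz.
right; case: w'V => [->|[x' x'V Ax']].
  by exists y; [rewrite mem_head|rewrite A2a eqxx].
exists x'; first by rewrite inE x'V orbT.
rewrite A2a; case: eqP => [E1|_]; first by rewrite E1 Av in Ax'.
case: eqP => [E1|_] //; rewrite E1 Aw in Ax'; case: Ax' => E2.
by rewrite E2 x'V in yV.
Qed.

(** Pigeonhole at one vertex: were all [n - lo] colours in use, they would lead to distinct
    neighbours other than [x0], and [x0] would make one neighbour too many. *)
Lemma free_colour (f : nat -> nat) (h : pred nat) N x0 :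
  (forall c c' x, f c = x.+1 -> f c' = x.+1 -> c = c') ->
  (forall c x, f c = x.+1 -> [&& x < N, h x & x != x0]) ->
  x0 < N -> h x0 -> count h (iota 0 N) <= n - lo ->
  exists2 c, lo <= c < n & f c = 0.
Proof.
move=> J H lt0 h0 le_h.
case: (boolP (has (fun c => f c == 0) (iota lo (n - lo)))) => [/hasP[c]|].
  by rewrite mem_iota => Hc /eqP Fc; exists c => //; lia.
move/hasPn => nz.
have fS c : c \in iota lo (n - lo) -> f c = (f c).-1.+1.
  by move/nz; case: (f c).
pose X := [seq (f c).-1 | c <- iota lo (n - lo)].
have : size (x0 :: X) <= size (filter h (iota 0 N)).
  apply: uniq_leq_size.
    rewrite cons_uniq; apply/andP; split.
      by apply/mapP=> -[c /fS/H/and3P[_ _ /eqP ne] E]; apply: ne; rewrite -E.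
    rewrite map_inj_in_uniq ?iota_uniq // => c c' /fS Ec /fS Ec' E.
    by apply: J Ec _; rewrite E.
  move=> x; rewrite inE mem_filter mem_iota => /orP[/eqP->|/mapP[c /fS/H]].
    by rewrite h0.
  by case/and3P=> ltc hc _ ->; rewrite hc.
by rewrite /= size_map size_iota size_filter; lia.
Qed.

(** A colour leads to at most one neighbour, so [n - lo] neighbours need all [n - lo] colours. *)
Lemma saturated (f : nat -> nat) (h : pred nat) N c0 :
  (forall c x, f c = x.+1 -> lo <= c < n) ->
  (forall x, x < N -> h x -> exists c, f c = x.+1) ->
  count h (iota 0 N) = n - lo -> lo <= c0 < n -> f c0 != 0.
Proof.
move=> L C Eh Lc0.
pose X := [seq (f c).-1 | c <- iota lo (n - lo) & f c != 0].
have : size (filter h (iota 0 N)) <= size X.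
  apply: uniq_leq_size; first by rewrite filter_uniq ?iota_uniq.
  move=> x; rewrite mem_filter mem_iota => /andP[hx /= lt_x].
  have [c Ec] := C _ lt_x hx; apply/mapP; exists c; last by rewrite Ec.
  by rewrite mem_filter Ec mem_iota /=; have := L _ _ Ec; lia.
rewrite size_map !size_filter Eh => le_c.
have : all (fun c => f c != 0) (iota lo (n - lo)).
  by rewrite all_count size_iota eqn_leq le_c andbT -[leqRHS](size_iota lo) count_size.
by move/allP; apply; rewrite mem_iota; lia.
Qed.

End Colouring.

(** * Inserting one edge by a program *)

Definition same_except d (p q : nat) (st0 st : state) :=
  (forall k, k < d -> reg st k = reg st0 k) /\
  (forall k, k != p -> k != q -> mem st k =2 mem st0 k).

Lemma same_except_trans d p q st1 st2 st3 :
  same_except d p q st1 st2 -> same_except d p q st2 st3 ->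
  same_except d p q st1 st3.
Proof.
move=> [R12 M12] [R23 M23]; split=> [k lt_k|k kp kq i j].
  by rewrite R23 ?R12.
by rewrite M23 ?M12.
Qed.

Lemma same_except_le d d' p q st1 st2 :
  d' <= d -> same_except d p q st1 st2 -> same_except d' p q st1 st2.
Proof. by move=> le_d [R M]; split=> // k lt_k; apply: R; lia. Qed.

(* Registers 4 and 5 hold the edge to be inserted, 6 and 7 the two colours of *)
(* its chain, 8 and 9 the ends of the pending edge, 10 is scratch.            *)
Definition pred_reg x := Minus (Reg x) (Const 1).

(* Registers [v] and [y] hold the successors of the two ends of the edge that *)
(* gets colour [c]; afterwards [v] holds the successor of the evicted end.    *)
Definition evict p q v y c :=
  Seq (Assign 10 (Cell q (pred_reg y) (Reg c)))
  (Seq (If (Reg 10) (Store p (pred_reg 10) (Reg c) (Const 0)) Skip)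
  (Seq (Store p (pred_reg v) (Reg c) (Reg y))
  (Seq (Store q (pred_reg y) (Reg c) (Reg v))
       (Assign v (Reg 10))))).

Lemma run_evict (p q : nat) v y c st v0 y0 :
  p != q -> uniq [:: v; y; c; 10] -> reg st v = v0.+1 -> reg st y = y0.+1 ->
  let st' := run (evict p q v y c) st in
  [/\ mem st' p =2 evictA (mem st p) (mem st q) v0 y0 (reg st c),
      mem st' q =2 upd (mem st q) y0 (reg st c) v0.+1,
      forall k, k != p -> k != q -> mem st' k =2 mem st k,
      reg st' v = mem st q y0 (reg st c) &
      forall k, k != v -> k != 10 -> reg st' k = reg st k].
Proof.
move=> /negPf pq /= /and4P[]; rewrite !inE !negb_or => /and3P[vy vc v10].
move=> /andP[yc y10] c10 _ Ev Ey; rewrite eqxx.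
rewrite (negPf c10) Ey !subSS !subn0.
have qp : (q == p) = false by rewrite eq_sym.
case Ew: (mem st q y0 (reg st c)) => [|w] /=.
all: rewrite ?(negPf v10) ?(negPf y10) ?(negPf c10) Ey Ev !subSS !subn0 /=.
all: split=> [k l|k l|k /negPf kp /negPf kq i j||k /negPf kv /negPf k10];
  rewrite /evictA /upd ?Ew ?eqxx ?pq ?qp ?kp ?kq ?kv ?k10 //=.
Qed.

Definition search x p i lo :=
  Seq (Assign x (Reg lo))
    (While (Cell p (Reg i) (Reg x)) (Assign x (Plus (Reg x) (Const 1)))).

(** The scan never compares its register with [n]; the known free colour [c0] stops it, and the
    distance to [c0] is the fuel. *)
Lemma hoare_search x p i lo n c0 st0 :
  i != x -> reg st0 lo <= c0 < n -> mem st0 p (reg st0 i) c0 = 0 ->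
  hoare (2 * n + 2) (eq st0) (search x p i lo)
    (fun st => [/\ forall k, k != x -> reg st k = reg st0 k, mem st = mem st0,
       reg st0 lo <= reg st x < n & mem st0 p (reg st0 i) (reg st x) = 0]).
Proof.
move=> ix /andP[le_c lt_c] free.
pose J d st := [/\ forall k, k != x -> reg st k = reg st0 k, mem st = mem st0,
  reg st0 lo <= reg st x & reg st x + d = c0].
apply: (@hoare_weaken (1 + ((c0 - reg st0 lo) * 2).+1) _ (eq st0) _
  (fun st => (exists d, J d st) /\ eval st (Cell p (Reg i) (Reg x)) = 0)) => //.
- lia.
- move=> st [[d [HR HM le_x Ed]] /=]; rewrite HM HR // => E.
  by split=> //; rewrite le_x; lia.
apply: (@hoare_seq _ _ _ (J (c0 - reg st0 lo))).
  apply: (@hoare_run _ _ (Assign x (Reg lo))) => // st <-.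
  by split=> //= [k /negPf->||]; rewrite ?eqxx //; lia.
apply: (@hoare_while 1 J) => [d st [HR HM le_x Ed] /=|d].
  rewrite HM HR //; case: d Ed => // Ed; rewrite addn0 in Ed.
  by rewrite Ed free.
apply: (@hoare_run _ _ (Assign x (Plus (Reg x) (Const 1)))) => //.
move=> st [[HR HM le_x Ed] _]; split=> //= [k kx||]; rewrite ?eqxx //; try lia.
by rewrite (negPf kx) HR.
Qed.

(** The second [evict] exchanges the two tables and the two ends. It leaves in register 9 the
    successor of the next symbol of the chain, or 0 when nothing was evicted, which ends the
    loop. *)
Definition augment p q :=
  While (Reg 9)
    (Seq (evict p q 8 9 6) (If (Reg 8) (evict q p 9 8 7) (Assign 9 (Const 0)))).

Definition insert p q lo :=
  Seq (search 6 p 4 lo)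
  (Seq (search 7 q 5 lo)
  (Seq (Assign 8 (Plus (Reg 4) (Const 1)))
  (Seq (Assign 9 (Plus (Reg 5) (Const 1)))
       (augment p q)))).

Lemma hoare_augment (p q : nat) lo n (E : rel nat) st0 u x :
  p != q -> (forall u' x', E u' x' -> x' < n) ->
  reg st0 8 = u.+1 -> reg st0 9 = x.+1 ->
  lo <= reg st0 6 < n -> lo <= reg st0 7 < n ->
  E u x -> mem st0 p u (reg st0 6) = 0 -> mem st0 q x (reg st0 7) = 0 ->
  colouring lo n (minus E u x) (mem st0 p) (mem st0 q) ->
  hoare (n * 17).+1 (eq st0) (augment p q)
    (fun st => same_except 8 p q st0 st /\
               colouring lo n E (mem st p) (mem st q)).
Proof.
move=> pq ltE E8 E9; move Ea: (reg st0 6) => a; move Eb: (reg st0 7) => b.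
move=> La Lb Eux Au Bx col.
pose I m st := same_except 8 p q st0 st /\
  ((reg st 9 = 0 /\ colouring lo n E (mem st p) (mem st q)) \/
   exists v y V, [/\ reg st 8 = v.+1, reg st 9 = y.+1,
     pending lo n E (mem st p) (mem st q) a b v y V,
     {subset V <= iota 0 n} & m + size V = n]).
apply: (@hoare_weaken (n * 17).+1 _ (I n) _
  (fun st => (exists k, I k st) /\ eval st (Reg 9) = 0)) => //.
- move=> st <-; split; first by split.
  right; exists u, x, [::]; split=> //; last by rewrite addn0.
- move=> st [[m [same [[_ ?]|[v [y [V [_ E9' _ _ _]]]]]]] /= E0] //.
  by rewrite E0 in E9'.
(* The loop body has [cmd_size] 16. While the chain is open, [y :: V] consists of distinct numbers
   below [n], so some fuel [n - size V] remains. *)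
apply: (@hoare_while 16 I) => [m st [_ [[/= -> //]|]]|m].
  case=> v [y [V [_ _ [_ Evy _ _ [_ uV]] sV sz]]] _.
  have : size (y :: V) <= size (iota 0 n).
    apply: uniq_leq_size => // z; rewrite inE => /orP[/eqP->|/sV//].
    by rewrite mem_iota (ltE _ _ Evy).
  by rewrite size_iota /=; lia.
apply: (@hoare_run _ _ (Seq _ (If _ _ _))) => // st.
move=> [[[HR HM] alt] ne0]; case: alt => [[E0 _]|[v [y [V [Ev Ey pen sV sz]]]]].
  by rewrite /= E0 in ne0.
have sa : reg st 6 = a by rewrite HR.
have sb : reg st 7 = b by rewrite HR.
have [P1 Q1 M1 V1 R1] := run_evict (v := 8) (y := 9) (c := 6) pq isT Ev Ey.
rewrite -[run (Seq _ _) st]/(let st1 := run (evict p q 8 9 6) st in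
  if reg st1 8 == 0 then set_reg st1 9 0 else run (evict q p 9 8 7) st1).
move: (run (evict p q 8 9 6) st) P1 Q1 M1 V1 R1 => st1 P1 Q1 M1 V1 R1.
cbv zeta.
rewrite V1 sa; rewrite !sa in P1 Q1 V1.
have [pcol Evy Av By [vis uV]] := pen.
case Bya : (mem st q y a) => [|w].
  split; first split=> [k lt_k|k kp kq i j] /=.
  - by have -> : k == 9 = false by [lia]; rewrite R1 ?HR //; lia.
  - by rewrite M1 ?HM.
  left; split=> //=.
  have := colouring_evict pcol Evy Av La; rewrite Bya.
  exact: colouring_ext.
rewrite Bya in V1.
have qp : q != p by rewrite eq_sym.
have Ey1 : reg st1 9 = y.+1 by rewrite R1.
have [Q2 P2 M2 V2 R2] := run_evict (v := 9) (y := 8) (c := 7) qp isT Ey1 V1.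
move: (run _ st1) Q2 P2 M2 V2 R2; rewrite R1 // sb => st2 Q2 P2 M2 V2 R2.
split; first split=> [k lt_k|k kp kq i j].
- by rewrite R2 ?R1 ?HR //; lia.
- by rewrite M2 ?M1 ?HM.
have stepA := pending_step pen La Lb Bya.
have eqA : upd (evictA (mem st p) (mem st q) v y a) w b y.+1 =2 mem st2 p.
  by move=> i j; rewrite P2 /upd P1.
have eqB : evictA (upd (mem st q) y a v.+1)
    (evictA (mem st p) (mem st q) v y a) y w b =2 mem st2 q.
  by move=> i j; rewrite Q2; apply: evictA_ext => k l; rewrite ?Q1 ?P1.
move: stepA; rewrite /= -P1 -V2; case Ez: (reg st2 9) => [|z].
  by move=> H; left; split=> //; apply: colouring_ext H.
move=> H; right; exists w, z, (y :: V); split=> //.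
- by rewrite R2.
- case: H => H1 H2 H3 H4 [H5 H6]; split=> //.
  + exact: colouring_ext H1.
  + by rewrite -eqA.
  + by rewrite -eqB.
  split=> // i /H5 [w' Bi H]; exists w'; first by rewrite -eqB.
  by case: H => [->|[i' i'V Aw']]; [left|right; exists i'; rewrite -?eqA].
- move=> i; rewrite inE => /orP[/eqP->|/sV//].
  by rewrite mem_iota (ltE _ _ Evy).
- by rewrite /=; lia.
Qed.

Lemma hoare_insert (p q : nat) lo n (E : rel nat) st0 c d :
  p != q -> (forall u x, E u x -> x < n) -> lo < 4 ->
  reg st0 lo <= c < n -> mem st0 p (reg st0 4) c = 0 ->
  reg st0 lo <= d < n -> mem st0 q (reg st0 5) d = 0 ->
  E (reg st0 4) (reg st0 5) ->
  colouring (reg st0 lo) n (minus E (reg st0 4) (reg st0 5))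
    (mem st0 p) (mem st0 q) ->
  hoare (21 * n + 7) (eq st0) (insert p q lo)
    (fun st => same_except 6 p q st0 st /\
               colouring (reg st0 lo) n E (mem st p) (mem st q)).
Proof.
move=> pq ltE lo4 Lc Ac Ld Bd Eux col.
pose S4 st := [/\ forall k, k < 6 -> reg st k = reg st0 k, mem st = mem st0,
   reg st0 lo <= reg st 6 < n, mem st0 p (reg st0 4) (reg st 6) = 0 &
   reg st0 lo <= reg st 7 < n /\ mem st0 q (reg st0 5) (reg st 7) = 0].
apply: (@hoare_weaken ((2 * n + 2) + ((2 * n + 2) + (1 + (1 + (n * 17).+1))))
  _ _ _ _ _ _ _ (fun _ H => H) (fun _ H => H)); first lia.
apply: hoare_seq (hoare_search (n := n) (c0 := c) _ _ _) _ => //.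
apply: (@hoare_seq _ _ _ S4).
  move=> st1 [R1 M1 L1 A1].
  have [||st' [T [X L [R2 M2 L2 B2]]]] := hoare_search (x := 7) (p := q) (i := 5)
     (lo := lo) (n := n) (c0 := d) (st0 := st1) isT _ _ erefl.
  - by rewrite R1 //; lia.
  - by rewrite M1 R1.
  exists st', T; split=> //; split.
  - by move=> k lt_k; rewrite R2 ?R1 //; lia.
  - by rewrite M2.
  - by rewrite R2.
  - by rewrite R2.
  by move: L2 B2; rewrite M1 !R1 //; lia.
apply: (@hoare_seq _ _ _ (fun st => S4 st /\ reg st 8 = (reg st0 4).+1)).
  apply: (@hoare_run _ _ (Assign 8 _)) => // st [HR HM H1 H2 H3] /=.
  split; last by rewrite HR // addn1.
  by split=> //= k lt_k; have -> : k == 8 = false by [lia]; exact: HR.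
apply: (@hoare_seq _ _ _ (fun st => [/\ S4 st, reg st 8 = (reg st0 4).+1
   & reg st 9 = (reg st0 5).+1])).
  apply: (@hoare_run _ _ (Assign 9 _)) => // st [[HR HM H1 H2 H3] H8] /=.
  split=> //; last by rewrite HR // addn1.
  by split=> //= k lt_k; have -> : k == 9 = false by [lia]; exact: HR.
move=> st [[HR HM H1 H2 [H3 H4]] H8 H9].
have [|||st' [T [X L [same Hcol]]]] :=
  hoare_augment pq ltE H8 H9 H1 H3 Eux _ _ _ erefl; try by rewrite HM.
exists st', T; split=> //; split=> //.
apply: same_except_trans (same_except_le _ same) => //.
by split=> // k _ _ i j; rewrite HM.
Qed.

(** * Colouring a whole graph edge by edge *)

(** Array [g] holds the complement of the graph, because the input tables list forbidden symbols.
    Register [lo] holds the first colour and register [U] the number of vertices on the first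
    side. *)
Definition colour p q g lo U :=
  For2 (Const 0) (Reg U) (Reg 3) (If (Cell g (Reg 4) (Reg 5)) Skip (insert p q lo)).

Definition before i j : rel nat := fun u x => (u < i) || ((u == i) && (x < j)).

Lemma hoare_colour (p q g : nat) lo U n N (st0 : state) :
  p != q -> g != p -> g != q -> lo < 4 -> U < 4 ->
  reg st0 3 = n -> reg st0 U = N -> N <= n ->
  (forall u x, mem st0 p u x = 0) -> (forall u x, mem st0 q u x = 0) ->
  (forall u, u < N ->
     count (fun x => mem st0 g u x == 0) (iota 0 n) <= n - reg st0 lo) ->
  (forall x, x < n ->
     count (fun u => mem st0 g u x == 0) (iota 0 N) <= n - reg st0 lo) ->
  hoare (n * (n * (21 * n + 10) + 4) + 2) (eq st0) (colour p q g lo U)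
    (fun st => same_except 4 p q st0 st /\
       colouring (reg st0 lo) n
         (fun u x => [&& u < N, x < n & mem st0 g u x == 0])
         (mem st p) (mem st q)).
Proof.
move=> pq gp gq lo4 U4 En EN leN p0 q0 degU degX.
pose edge u x := [&& u < N, x < n & mem st0 g u x == 0].
pose I i j st := same_except 4 p q st0 st /\
  colouring (reg st0 lo) n (fun u x => edge u x && before i j u x)
    (mem st p) (mem st q).
apply: (@hoare_weaken (n * (n * ((21 * n + 8) + 2) + 4) + 2) _ (eq st0) _ (I N 0)) => //.
- by rewrite -addnA.
- move=> st [same col]; split=> //; apply: colouring_ext col => // u x.
  by rewrite /edge /before ltn0 andbF orbF; case: ltnP; rewrite ?andbT ?andbF.
apply: (hoare_for2 (m := 0) (M := n)) => //.
- move=> st <-; split=> //; split; first by split.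
  split=> [u c x|u c x|u c c' x|u x]; rewrite ?p0 ?q0 //.
  by rewrite /before !ltn0 !andbF; split=> // -[c]; rewrite p0.
- by move=> i j st [[HR _] _]; rewrite !HR.
- move=> i j st x v lt3 [[HR HM] col]; split=> //; split=> //= k lt_k.
  by have -> : k == x = false by [lia]; exact: HR.
- move=> i st [same col]; split=> //; apply: colouring_ext col => // u x.
  by rewrite /edge /before ltnS; case: (ltnP x n); rewrite /= ?andbF //; lia.
move=> i j /= lt_i lt_j; rewrite addnS; apply: hoare_if.
  apply: (@hoare_weaken 1 _ _ _ _ _ _ _ (fun _ H => H) (fun _ H => H)); first lia.
  apply: (@hoare_run _ _ Skip) => // st [[[[HR HM] col] E4 E5]] /=.
  rewrite E4 E5 HM // => ne0; split=> //; split=> //.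
  apply: colouring_ext col => // u x; rewrite /edge /before.
  case: (eqVneq u i) => [->|//]; case: (eqVneq x j) => [->|xj].
    by rewrite (negPf ne0) !andbF.
  by rewrite ltnS [x <= j]leq_eqVlt (negPf xj).
move=> st [[[[HR HM] col] E4 E5]] /=; rewrite E4 E5 HM // => g0.
have Elo : reg st lo = reg st0 lo by rewrite HR.
have notyet u x : edge u x && before i j u x -> (u, x) != (i, j).
  by case/andP=> _; apply: contraTneq => -[-> ->]; rewrite /before; lia.
have [D L J C] := col.
have [c Lc Fc] : exists2 c, reg st0 lo <= c < n & mem st p i c = 0.
  apply: (free_colour (h := fun x => mem st0 g i x == 0) (x0 := j) _ _ lt_j _ (degU _ lt_i)).
  - by move=> c c' x; exact: J.
  - move=> c x H; have F : edge i x && before i j i x by apply/C; exists c.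
    have := notyet _ _ F; rewrite xpair_eqE eqxx /= => ->.
    by case/andP: F => /and3P[_ -> ->].
  by rewrite g0.
have [d Ld Fd] : exists2 d, reg st0 lo <= d < n & mem st q j d = 0.
  apply: (free_colour (h := fun u => mem st0 g u j == 0) (x0 := i) _ _ lt_i _ (degX _ lt_j)).
  - by move=> c1 c' x /D H1 /D; exact: J H1.
  - move=> c1 u /D H; have F : edge u j && before i j u j by apply/C; exists c1.
    have := notyet _ _ F; rewrite xpair_eqE eqxx andbT /= => ->.
    by case/andP: F => /and3P[-> _ ->].
  by rewrite g0.
have [|||||||st' [T [X LT [[HR' HM'] col']]]] := @hoare_insert p q lo n
  (fun u x => edge u x && before i j.+1 u x) st c d pq _ lo4 _ _ _ _ _ _ _ erefl.
- by move=> u x /andP[/and3P[]].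
- by rewrite Elo.
- by rewrite E4.
- by rewrite Elo.
- by rewrite E5.
- by rewrite E4 E5 /edge /before lt_i lt_j g0 !eqxx ltnSn orbT.
- rewrite Elo E4 E5; apply: colouring_ext col => // u x.
  rewrite /minus xpair_eqE /before /edge.
  case: (eqVneq u i) => [->|ui]; last by rewrite andbT.
  by case: (eqVneq x j) => [->|xj] /=; rewrite ?ltnn ?andbF ?andbT //=
    ltnS [x <= j]leq_eqVlt (negPf xj).
exists st', T; split=> //; split; try by rewrite HR'.
split; last by rewrite -Elo.
split=> [k lt_k|k kp kq i' j']; first by rewrite HR' ?HR //; lia.
by rewrite HM' ?HM.
Qed.

(** * Cardinalities as counts over intervals of numbers *)

Lemma count_incidence m t (A : 'I_m -> {set 'I_t}) (i : 'I_m) n :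
  t <= n -> count (incidence A i) (iota 0 n) = #|A i|.
Proof.
move=> le_tn; rewrite -size_filter -(size_image val) //.
apply/perm_size/uniq_perm; rewrite ?filter_uniq ?iota_uniq //.
  by rewrite map_inj_uniq ?enum_uniq //; exact: val_inj.
move=> x; rewrite mem_filter mem_iota /=; apply/andP/imageP.
  by case=> /existsP[i' /existsP[x' /and3P[/eqP/val_inj-> /eqP<- xA]]] _; exists x'.
case=> x' xA ->; split; last exact: leq_trans (ltn_ord _) le_tn.
by apply/existsP; exists i; apply/existsP; exists x'; rewrite !eqxx.
Qed.

Lemma count_incidence_col m t (A : 'I_m -> {set 'I_t}) (x : 'I_t) n :
  m <= n -> count (fun i => incidence A i x) (iota 0 n) = #|[set i | x \in A i]|.
Proof.
move=> le_mn; rewrite -size_filter -(size_image val).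
apply/perm_size/uniq_perm; rewrite ?filter_uniq ?iota_uniq //.
  by rewrite map_inj_uniq ?enum_uniq //; exact: val_inj.
move=> i; rewrite mem_filter mem_iota /=; apply/andP/imageP.
  case=> /existsP[i' /existsP[x' /and3P[/eqP<- /eqP/val_inj-> xA]]] _.
  by exists i'; rewrite ?inE.
case=> i'; rewrite inE => xA ->; split; last exact: leq_trans (ltn_ord _) le_mn.
by apply/existsP; exists i'; apply/existsP; exists x; rewrite !eqxx.
Qed.

Lemma incidence_lt m t (A : 'I_m -> {set 'I_t}) i x :
  incidence A i x -> (i < m) && (x < t).
Proof. by case/existsP=> i' /existsP[x' /and3P[/eqP<- /eqP<- _]]; rewrite !ltn_ord. Qed.

Lemma incidence_symbols m t (A : 'I_m -> {set 'I_t}) (i : 'I_m) n (x : 'I_n) :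
  (x \in symbols n (A i)) = incidence A i x.
Proof.
rewrite inE; apply/existsP/existsP => [[y /andP[yA /eqP Ey]]|[i' /existsP[y]]].
  by exists i; apply/existsP; exists y; rewrite Ey !eqxx.
case/and3P=> /eqP/val_inj-> /eqP Ey yA.
by exists y; rewrite yA Ey eqxx.
Qed.

Lemma count_not (h : pred nat) m n :
  count (fun x => ~~ h x) (iota m n) = n - count h (iota m n).
Proof. by rewrite -{2}(size_iota m n) -(count_predC h) addKn. Qed.

(** * Degrees in the two graphs and assembly of the square *)

Section Degrees.

Variables (r s n : nat) (Rw Cl : rel nat).
Hypothesis le_rsn : r + s <= n.
Hypothesis Rw_row : forall i, i < r -> count (Rw i) (iota 0 n) = s.
Hypothesis Cl_row : forall j, j < s -> count (Cl j) (iota 0 n) = r.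
Hypothesis Rw_lt : forall i x, Rw i x -> i < r.
Hypothesis RwCl : forall x,
  count (fun i => Rw i x) (iota 0 r) = count (fun j => Cl j x) (iota 0 s).

Variables A B : nat -> nat -> nat.
Hypothesis col :
  colouring r n (fun j x => [&& j < s, x < n & ~~ Cl j x]) A B.

(** Column [j] avoids [r] symbols, so its degree [n - r] equals the number of colours. *)
Lemma left_full j i : j < s -> r <= i < n -> A j i != 0.
Proof.
move=> lt_j; have [D L J C] := col.
apply: (saturated (h := fun x => ~~ Cl j x) (N := n)) => [c x|x lt_x hx|].
- exact: L.
- by apply/C/and3P.
- by rewrite count_not Cl_row.
Qed.

(* Symbols that may not be used in row [i] to the right of the first [s]      *)
(* columns.                                                                   *)
Definition barred i x :=
  Rw i x || ((r <= i < n) && has (fun j => A j i == x.+1) (iota 0 s)).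

(** A top row has its set of [s] symbols. In a lower row each of the [s] left cells is filled, and
    with different symbols, because colour [i] occurs once at a symbol. *)
Lemma barred_row i : i < n -> count (barred i) (iota 0 n) = s.
Proof.
move=> lt_i; have [D L J C] := col; case: (ltnP i r) => [lt_ir|le_ri].
  rewrite -[RHS](Rw_row lt_ir); apply: eq_count => x.
  by rewrite /barred leqNgt lt_ir orbF.
have nz j : j < s -> A j i = (A j i).-1.+1.
  by move=> lt_j; rewrite prednK // lt0n left_full ?le_ri.
rewrite -size_filter -[RHS](size_iota 0) -[RHS](size_map (fun j => (A j i).-1)).
apply/perm_size/uniq_perm; rewrite ?filter_uniq ?iota_uniq //.
  rewrite map_inj_in_uniq ?iota_uniq // => j j'.
  rewrite !mem_iota !add0n => /nz Ej /nz Ej' E.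
  move/D: Ej; rewrite E => Bj; move/D: Ej'; by rewrite Bj => -[].
move=> x; rewrite mem_filter mem_iota /barred le_ri lt_i /=.
have -> : Rw i x = false by apply/negP=> /Rw_lt; rewrite ltnNge le_ri.
apply/andP/mapP => [[/hasP[j js /eqP Aj] _]|[j js Ex]].
  by exists j; rewrite ?Aj.
have Aj : A j i = x.+1 by rewrite Ex -nz //; rewrite mem_iota in js.
split; first by apply/hasP; exists j; rewrite ?Aj.
by have /and3P[] : [&& j < s, x < n & ~~ Cl j x] by apply/C; exists i.
Qed.

(** By balance, the top rows that bar [x] are as many as the columns with [x] in their set. Each of
    the other columns contains [x] in exactly one lower row, and these rows differ; together this
    gives [s]. *)
Lemma barred_col x : x < n -> count (fun i => barred i x) (iota 0 n) = s.
Proof.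
move=> lt_x; have [D L J C] := col.
have En : n = r + (n - r) by lia.
rewrite En iotaD count_cat add0n.
have -> : count (fun i => barred i x) (iota 0 r) = count (fun j => Cl j x) (iota 0 s).
  rewrite -RwCl //; apply: eq_in_count => i; rewrite mem_iota /= => lt_i.
  by rewrite /barred leqNgt lt_i orbF.
rewrite -{2}(size_iota 0 s) -(count_predC (fun j => Cl j x)); congr (_ + _).
rewrite -2!size_filter -(size_map (fun i => (B x i).-1)).
have barredE i : i \in filter (fun i => barred i x) (iota r (n - r)) ->
    exists j, [/\ B x i = j.+1, j < s & ~~ Cl j x].
  rewrite mem_filter mem_iota => /andP[/orP[/Rw_lt|]]; first lia.
  case/andP=> _ /hasP[j _ /eqP Aj] _; exists j; split; first exact/D.
    by have /C/and3P[] : exists c, A j c = x.+1 by exists i.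
  by have /C/and3P[] : exists c, A j c = x.+1 by exists i.
apply/perm_size/uniq_perm; rewrite ?filter_uniq ?iota_uniq //.
  rewrite map_inj_in_uniq ?filter_uniq ?iota_uniq // => i i'.
  case/barredE=> j [Ej _ _] /barredE[j' [Ej' _ _]]; rewrite Ej Ej' /= => Ejj.
  by rewrite Ejj in Ej; apply: (J j' _ _ x); apply/D.
move=> j; rewrite mem_filter mem_iota /= add0n.
apply/mapP/andP => [[i /barredE[j' [-> lt_j nC]] ->]|[nC lt_j]] //.
have /C[i Ai] : [&& j < s, x < n & ~~ Cl j x] by apply/and3P.
exists i; last by rewrite ((D _ _ _).1 Ai).
have Li := L _ _ _ Ai.
rewrite mem_filter mem_iota /barred Li; apply/andP; split; last lia.
by apply/orP; right; apply/hasP; exists j; rewrite ?mem_iota ?Ai.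
Qed.

Variables A' B' : nat -> nat -> nat.
Hypothesis col' :
  colouring s n (fun i x => [&& i < n, x < n & ~~ barred i x]) A' B'.

Lemma right_full i j : i < n -> s <= j < n -> A' i j != 0.
Proof.
move=> lt_i; have [D L J C] := col'.
apply: (saturated (h := fun x => ~~ barred i x) (N := n)) => [c x|x lt_x hx|].
- exact: L.
- by apply/C/and3P.
- by rewrite count_not barred_row.
Qed.

(** The indices of [A] are swapped because in the first graph the vertices are columns and the
    colours are rows. *)
Definition assemble i j := if (r <= i) && (j < s) then A j i else A' i j.

Lemma assemble_empty i j :
  i < n -> j < n -> (assemble i j == 0) = (i < r) && (j < s).
Proof.
move=> lt_i lt_j; rewrite /assemble; have [D L J C] := col'.
case: (ltnP i r) => [lt_ir|le_ri]; case: (ltnP j s) => [lt_js|le_sj] /=.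
(* Colours of the second graph start at [s], so [A'] is 0 on the corner. *)
- by case E: (A' i j) => [|x] //; have := L _ _ _ E; lia.
- by apply/negbTE/right_full; rewrite ?le_sj.
- by apply/negbTE/left_full; rewrite ?le_ri.
- by apply/negbTE/right_full; rewrite ?le_sj.
Qed.

Lemma assemble_lt i j x : assemble i j = x.+1 -> x < n.
Proof.
have [_ _ _ C] := col; have [_ _ _ C'] := col'.
rewrite /assemble; case: ifP => _ E.
  by have /and3P[] : [&& j < s, x < n & ~~ Cl j x] by apply/C; exists i.
by have /and3P[] : [&& i < n, x < n & ~~ barred i x] by apply/C'; exists j.
Qed.

Lemma left_barred i j x : A j i = x.+1 -> j < s -> barred i x.
Proof.
have [_ L _ _] := col => E lt_j; rewrite /barred (L _ _ _ E) orbC.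
by apply/orP; left; apply/hasP; exists j; rewrite ?mem_iota ?E.
Qed.

(** On the left, a colour occurs once at a symbol; on the right, an edge has one colour. In
    [assemble_col] the two reasons are exchanged. A symbol placed on the left of a row is barred on
    its right. *)
Lemma assemble_row i j j' x :
  assemble i j = x.+1 -> assemble i j' = x.+1 -> j = j'.
Proof.
have [D L J C] := col; have [D' L' J' C'] := col'.
have excl k k' : A k i = x.+1 -> k < s -> A' i k' = x.+1 -> False.
  move=> /left_barred H /H bar E; have := (C' i x).2 (ex_intro _ _ E).
  by rewrite bar !andbF.
rewrite /assemble; case: ifP => [/andP[_ lt_j]|_] E; case: ifP => [/andP[_ lt_j']|_] E'.
- by have := (D _ _ _).1 E; rewrite ((D _ _ _).1 E') => -[].
- by case: (excl _ _ E lt_j E').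
- by case: (excl _ _ E' lt_j' E).
- exact: J' E E'.
Qed.

Lemma assemble_col i i' j x :
  assemble i j = x.+1 -> assemble i' j = x.+1 -> i = i'.
Proof.
have [D L J C] := col; have [D' L' J' C'] := col'.
have excl k k' : j < s -> A' k j = x.+1 -> i = k'.
  by move=> lt_j /L'; rewrite leqNgt lt_j.
rewrite /assemble; case: ifP => [/andP[_ lt_j]|_] E; case: ifP => [/andP[_ lt_j']|_] E'.
- exact: J E E'.
- exact: excl lt_j E'.
- exact: excl lt_j' E.
- by have := (D' _ _ _).1 E; rewrite ((D' _ _ _).1 E') => -[].
Qed.

Lemma assemble_row_missing i x : i < r -> x < n ->
  (forall j, j < n -> assemble i j <> x.+1) <-> Rw i x.
Proof.
move=> lt_i lt_x; have [D' L' J' C'] := col'.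
have bar : barred i x = Rw i x by rewrite /barred leqNgt lt_i orbF.
have E j : assemble i j = A' i j by rewrite /assemble leqNgt lt_i.
split=> [H|Ri j _].
  apply: contraT => nR.
  have /C'[j Aj] : [&& i < n, x < n & ~~ barred i x].
    by rewrite lt_x bar nR; lia.
  by case: (H j); rewrite ?E //; have := L' _ _ _ Aj; lia.
rewrite E => Aj; have := (C' i x).2 (ex_intro _ _ Aj).
by rewrite bar Ri !andbF.
Qed.

Lemma assemble_col_missing j x : j < s -> x < n ->
  (forall i, i < n -> assemble i j <> x.+1) <-> Cl j x.
Proof.
move=> lt_j lt_x; have [D L J C] := col; have [_ L' _ _] := col'.
split=> [H|Cj i _].
  apply: contraT => nC.
  have /C[i Ai] : [&& j < s, x < n & ~~ Cl j x] by rewrite lt_j lt_x.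
  have Li := L _ _ _ Ai.
  by case: (H i); rewrite ?/assemble ?lt_j; [lia|case/andP: Li => ->].
rewrite /assemble lt_j andbT; case: ifP => _ E.
  by have := (C j x).2 (ex_intro _ _ E); rewrite Cj !andbF.
by have := L' _ _ _ E; rewrite leqNgt lt_j.
Qed.

End Degrees.

(** * Passes between and after the colourings *)

(** Array 0 is turned in place from the table of the sets [rowset] into the table of [barred], the
    complement of the second graph. *)
Definition mark :=
  For2 (Reg 0) (Reg 3) (Reg 1)
    (Store 0 (Reg 4) (Minus (Cell 3 (Reg 5) (Reg 4)) (Const 1)) (Const 1)).

Lemma hoare_mark r s n st0 :
  reg st0 0 = r -> reg st0 1 = s -> reg st0 3 = n -> r + s <= n ->
  (forall i j, r <= i < n -> j < s -> mem st0 3 j i != 0) ->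
  hoare (n * (n * 3 + 4) + 2) (eq st0) mark
    (fun st => same_except 4 0 0 st0 st /\
       forall i x, (mem st 0 i x == 0) =
         ~~ ((mem st0 0 i x != 0) ||
             ((r <= i < n) && has (fun j => mem st0 3 j i == x.+1) (iota 0 s)))).
Proof.
move=> Er Es En le_n nz.
pose I i j st := same_except 4 0 0 st0 st /\
  forall i' x, (mem st 0 i' x == 0) =
    ~~ ((mem st0 0 i' x != 0) || ((r <= i') &&
      has (fun j' => before i j i' j' && (mem st0 3 j' i' == x.+1)) (iota 0 s))).
apply: (@hoare_weaken (n * (n * (1 + 2) + 4) + 2) _ (eq st0) _ (I n 0)) => //.
  move=> st [same M]; split=> // i x; rewrite M; congr (~~ (_ || _)).
  rewrite -andbA; congr (_ && _); case: (ltnP i n) => lt_i /=.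
    by apply: eq_has => j; rewrite /before lt_i.
  by apply/negbTE/hasPn => j _; rewrite /before ltn0 andbF orbF ltnNge lt_i.
apply: (hoare_for2 (m := r) (M := s)) => //; try lia.
- move=> st <-; split=> //; split=> // i x.
  rewrite (_ : (r <= i) && _ = false) ?orbF ?negbK //.
  case: (leqP r i) => //= le_ri; apply/negbTE/hasPn => j _.
  by rewrite /before ltn0 andbF orbF ltnNge le_ri.
- by move=> i j st [[HR _] _]; rewrite !HR.
- move=> i j st x v lt3 [[HR HM] M]; split=> //; split=> //= k lt_k.
  by have -> : k == x = false by [lia]; exact: HR.
- move=> i st [same M]; split=> // i' x; rewrite M; congr (~~ (_ || (_ && _))).
  apply: eq_in_has => j; rewrite mem_iota /= /before add0n => ->.
  by rewrite ltn0 andbF orbF andbT ltnS [i' <= i]leq_eqVlt orbC.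
move=> i j Li lt_j.
apply: (@hoare_run _ _ (Store 0 _ _ _)) => // st [[[HR HM] M] E4 E5] /=.
split=> //; split; first split=> // k k0 _ a b /=.
  by rewrite (negPf k0) /= HM.
move=> i' x /=; rewrite E4 E5 HM //.
have nzij := nz _ _ Li lt_j.
(* Here the entry must be nonzero: truncated subtraction would decode an empty cell as symbol 0. *)
have -> : (i' == i) && (x == mem st0 3 j i - 1) = (i' == i) && (mem st0 3 j i == x.+1).
  by congr (_ && _); lia.
have Eh : has (fun j' => before i j.+1 i' j' && (mem st0 3 j' i' == x.+1)) (iota 0 s)
  = has (fun j' => before i j i' j' && (mem st0 3 j' i' == x.+1)) (iota 0 s)
    || ((i' == i) && (mem st0 3 j i == x.+1)).
  apply/hasP/orP => [[j' js /andP[]]|[/hasP[j' js /andP[bef Ej]]|/andP[/eqP-> Ej]]].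
  - rewrite /before => /orP[lt_i|/andP[/eqP-> le_j]] Ej.
      by left; apply/hasP; exists j'; rewrite // /before lt_i.
    move: le_j; rewrite ltnS leq_eqVlt => /orP[/eqP E|lt_jj].
      by right; rewrite -E eqxx.
    by left; apply/hasP; exists j'; rewrite // /before eqxx lt_jj orbT.
  - exists j' => //; rewrite Ej andbT; move: bef; rewrite /before; lia.
  - by exists j; [rewrite mem_iota|rewrite Ej /before eqxx ltnSn orbT].
rewrite Eh andb_orr orbA negb_or -M.
case: ifP => [/andP[/eqP-> _]|_]; first by rewrite (andP Li).1 andbF.
by rewrite andbF andbT.
Qed.

Definition copy :=
  For2 (Reg 0) (Reg 3) (Reg 1) (Store 2 (Reg 4) (Reg 5) (Cell 3 (Reg 5) (Reg 4))).

Lemma hoare_copy r s n st0 :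
  reg st0 0 = r -> reg st0 1 = s -> reg st0 3 = n -> r + s <= n ->
  hoare (n * (n * 3 + 4) + 2) (eq st0) copy
    (fun st => forall i j, i < n ->
       mem st 2 i j = if (r <= i) && (j < s) then mem st0 3 j i else mem st0 2 i j).
Proof.
move=> Er Es En le_n.
pose I i j st := same_except 4 2 2 st0 st /\
  forall i' j', mem st 2 i' j' =
    if [&& r <= i', j' < s & before i j i' j'] then mem st0 3 j' i'
    else mem st0 2 i' j'.
apply: (@hoare_weaken (n * (n * (1 + 2) + 4) + 2) _ (eq st0) _ (I n 0)) => //.
  by move=> st [same M] i j lt_i; rewrite M /before lt_i /= andbT.
apply: (hoare_for2 (m := r) (M := s)) => //; try lia.
- move=> st <-; split=> //; split=> // i j.
  by rewrite /before ltn0 andbF orbF; case: ifP => //; lia.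
- by move=> i j st [[HR _] _]; rewrite !HR.
- move=> i j st x v lt3 [[HR HM] M]; split=> //; split=> //= k lt_k.
  by have -> : k == x = false by [lia]; exact: HR.
- move=> i st [same M]; split=> // i' j; rewrite M /before.
  rewrite (_ : [&& _, _ & _] = [&& r <= i', j < s &
    (i' < i.+1) || ((i' == i.+1) && (j < 0))]) //.
  by lia.
move=> i j Li lt_j.
apply: (@hoare_run _ _ (Store 2 _ _ _)) => // st [[[HR HM] M] E4 E5] /=.
split=> //; split; first split=> // k k0 _ a b /=.
  by rewrite (negPf k0) /= HM.
move=> i' j' /=; rewrite E4 E5 HM // M /before.
case: (eqVneq i' i) => [->|ni]; case: (eqVneq j' j) => [->|nj] //=.
- by rewrite lt_j ltnSn ltnn (andP Li).1.
- by rewrite ltnS [j' <= j]leq_eqVlt (negPf nj).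
Qed.

(** * The complete program and its correctness *)

(** The second colouring writes directly into the output array 2, whose convention for empty cells
    agrees with that of [colouring]; [copy] then adds the lower left part, transposed. *)
Definition program :=
  Seq (colour 3 4 1 0 1) (Seq mark (Seq (colour 2 5 0 1 3) copy)).

(** The sum is [42 n^3 + 26 n^2 + 16 n + 8], and 92 is the sum of these coefficients. *)
Lemma program_time n : 0 < n ->
  (n * (n * (21 * n + 10) + 4) + 2) +
   ((n * (n * 3 + 4) + 2) +
    ((n * (n * (21 * n + 10) + 4) + 2) + (n * (n * 3 + 4) + 2))) <= 92 * n ^ 3.
Proof.
move=> n_gt0; have le1 : n <= n * n by exact: leq_pmulr.
have le2 : n * n <= n * n * n by exact: leq_pmulr.
by rewrite !expnS expn0; lia.
Qed.

Lemma program_correct (R : framework) n :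
  balanced R -> maxn (nsym R) (nrow R + ncol R) <= n ->
  exists (st : state) (T : nat) (P : 'M[option 'I_n]_n),
    [/\ exec program (input R n) st T,
        T <= 92 * (framework_size R + n) ^ 3,
        outputs st P &
        realizes R P].
Proof.
case=> balR balC balRC; rewrite geq_max => /andP[le_tn le_rsn].
set r := nrow R in balR balC balRC le_rsn *.
set s := ncol R in balR balC balRC le_rsn *.
have r_gt0 : 0 < r := nrow_gt0 R.
set st0 := input R n.
pose Rw := incidence (@rowset R); pose Cl := incidence (@colset R).
have Rw_row i : i < r -> count (Rw i) (iota 0 n) = s.
  by move=> lt_i; rewrite -(balR (Ordinal lt_i)) -(count_incidence _ _ le_tn).
have Cl_row j : j < s -> count (Cl j) (iota 0 n) = r.
  by move=> lt_j; rewrite -(balC (Ordinal lt_j)) -(count_incidence _ _ le_tn).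
have Rw_lt i x : Rw i x -> i < r by case/incidence_lt/andP.
have RwCl x :
    count (fun i => Rw i x) (iota 0 r) = count (fun j => Cl j x) (iota 0 s).
  case: (ltnP x (nsym R)) => [lt_x|le_x].
    have := balRC (Ordinal lt_x).
    by rewrite -!(@count_incidence_col _ _ _ (Ordinal lt_x) _ (leqnn _)).
  (* Symbols from [nsym R] on belong to none of the sets, so both counts vanish. *)
  rewrite !(@eq_count _ _ pred0) ?count_pred0 // => i.
    by apply: contraTF le_x => /incidence_lt /andP[_]; rewrite ltnNge.
  by apply: contraTF le_x => /incidence_lt /andP[_]; rewrite ltnNge.
have mem0 i x : (mem st0 0 i x == 0) = ~~ Rw i x by rewrite /= eqb0.
have mem1 j x : (mem st0 1 j x == 0) = ~~ Cl j x by rewrite /= eqb0.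
have [|j lt_j|x lt_x|st1 [T1 [X1 L1 [same1 col1]]]] :=
  @hoare_colour 3 4 1 0 1 n s st0 isT isT isT isT isT erefl erefl _
    (fun _ _ => erefl) (fun _ _ => erefl) _ _ _ erefl.
- lia.
- by rewrite (eq_count (mem1 j)) count_not Cl_row.
(* A symbol has degree at most the number [s] of columns, and [s <= n - r]. *)
- apply: leq_trans (count_size _ _) _; rewrite size_iota /=; lia.
have {}col1 : colouring r n (fun j x => [&& j < s, x < n & ~~ Cl j x])
    (mem st1 3) (mem st1 4).
  by apply: colouring_ext col1 => // j x; rewrite mem1.
have [R1 M1] := same1.
have full1 i j : r <= i < n -> j < s -> mem st1 3 j i != 0.
  by move=> Li lt_j; apply: (left_full Cl_row col1).
have [st2 [T2 [X2 L2 [same2 mark2]]]] :=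
  hoare_mark (R1 0 isT) (R1 1 isT) (R1 3 isT) le_rsn full1 erefl.
have [R2 M2] := same2.
have bar2 i x : (mem st2 0 i x == 0) = ~~ barred r s n Rw (mem st1 3) i x.
  by rewrite mark2 /barred M1 // mem0 negbK.
have E3 : reg st2 3 = n by rewrite R2 ?R1.
have E1 : reg st2 1 = s by rewrite R2 ?R1.
have E0 : reg st2 0 = r by rewrite R2 ?R1.
have [||i lt_i|x lt_x|st3 [T3 [X3 L3 [same3 col3]]]] :=
  @hoare_colour 2 5 0 1 3 n n st2 isT isT isT isT isT E3 E3 (leqnn _) _ _ _ _ _ erefl.
- by move=> u x; rewrite M2 ?M1.
- by move=> u x; rewrite M2 ?M1.
- by rewrite (eq_count (bar2 i)) count_not E1 (barred_row Rw_row Cl_row Rw_lt col1).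
- rewrite (eq_count (fun i => bar2 i x)) count_not E1.
  by rewrite (barred_col le_rsn Rw_lt RwCl col1).
have {}col3 : colouring s n
    (fun i x => [&& i < n, x < n & ~~ barred r s n Rw (mem st1 3) i x])
    (mem st3 2) (mem st3 5).
  by rewrite E1 in col3; apply: colouring_ext col3 => // i x; rewrite bar2.
have [R3 M3] := same3.
have [st4 [T4 [X4 L4 out4]]] := @hoare_copy r s n st3
  (etrans (R3 0 isT) E0) (etrans (R3 1 isT) E1) (etrans (R3 3 isT) E3) le_rsn _ erefl.
pose out := assemble r s (mem st1 3) (mem st3 2).
have {}out4 (i j : 'I_n) : mem st4 2 i j = out i j.
  by rewrite out4 // M3 // M2.
(* By [assemble_lt] the argument of [insub] is always below [n], so [None] arises from the entry 0
   only. *)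
pose P : 'M[option 'I_n]_n :=
  (\matrix_(i, j) (if out i j is x.+1 then insub x else None))%R.
have PE (i j x : 'I_n) : P i j = Some x <-> out i j = x.+1.
  rewrite mxE; case E: (out i j) => [|y]; first by split.
  split=> [|[->]]; last by rewrite valK.
  by case: insubP => // u _ Eu [<-]; rewrite Eu.
have PN (i j : 'I_n) : (P i j == None) = (out i j == 0).
  rewrite mxE; case E: (out i j) => [|y] //=.
  have lt_y : y < n := assemble_lt col1 col3 E.
  by rewrite insubT.
exists st4, (T1 + (T2 + (T3 + T4))), P; split.
- by do 3![apply: exec_seq; first by eassumption].
- apply: (@leq_trans (92 * n ^ 3)); last by rewrite leq_mul2l leq_exp2r // leq_addl.
  apply: leq_trans (program_time _); last lia.
  by do ![apply: leq_add].
- move=> i j; rewrite out4; case E: (P i j) => [x|]; first exact/PE.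
  by apply/eqP; rewrite -PN E.
split.
- split=> [i j j' x /PE E /PE E'|i i' j x /PE E /PE E']; apply: val_inj.
    exact: (assemble_row col1 col3 E E').
  exact: (assemble_col col1 col3 E E').
- move=> i j; rewrite PN.
  exact: (assemble_empty le_rsn Rw_row Cl_row Rw_lt col1 col3 (ltn_ord i) (ltn_ord j)).
- move=> i lt_i; apply/setP=> x; rewrite incidence_symbols inE.
  have H := assemble_row_missing le_rsn col3 lt_i (ltn_ord x).
  apply/forallP/idP => [miss|/H miss j]; last first.
    by apply/eqP=> /PE; exact: miss.
  apply/H=> j lt_j E; have /eqP := miss (Ordinal lt_j); apply.
  exact/PE.
- move=> j lt_j; apply/setP=> x; rewrite incidence_symbols inE.
  have H := assemble_col_missing le_rsn col1 col3 lt_j (ltn_ord x).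
  apply/forallP/idP => [miss|/H miss i]; last first.
    by apply/eqP=> /PE; exact: miss.
  apply/H=> i lt_i E; have /eqP := miss (Ordinal lt_i); apply.
  exact/PE.
Qed.

Theorem theorem13 :
  (forall (R : framework) (n : nat),
     balanced R -> maxn (nsym R) (nrow R + ncol R) <= n ->
     exists P : 'M[option 'I_n]_n, realizes R P)
  /\
  (exists (c : cmd) (a k : nat),
     forall (R : framework) (n : nat),
       balanced R -> maxn (nsym R) (nrow R + ncol R) <= n ->
       exists (st : state) (T : nat) (P : 'M[option 'I_n]_n),
         [/\ exec c (input R n) st T,
             T <= a * (framework_size R + n) ^ k,
             outputs st P &
             realizes R P]).
Proof.
split=> [R n bal le_n|]; last by exists program, 92, 3; exact: program_correct.
by have [st [T [P []]]] := program_correct bal le_n; exists P.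
Qed.
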